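(* Let $(X,\tau,E)$ be a soft topological space over $X$ and let $(F,E)$ be a soft set over $X$. Then: (1) $(F,E)$ is a soft semi-open set over $X$ if and only if $(F,E)\cap \mathrm{bd}^s(F,E)=\Phi$; (2) $(F,E)$ is a soft semi-closed set over $X$ if and only if $\mathrm{bd}^s(F,E)\subseteq(F,E)$.
   Context: Let $X$ be a universe and $E$ a nonempty set of parameters. A soft set $(F,E)$ over $X$ is a mapping $F:E\to P(X)$, where $P(X)$ is the power set of $X$. Inclusion $(F,E)\subseteq(G,E)$, union and intersection of soft sets are taken parameterwise (e.g. $(F,E)\subseteq(G,E)$ iff $F(e)\subseteq G(e)$ for all $e\in E$). $\Phi$ is the soft set with value $\emptyset$ at every parameter and $\widetilde X$ the soft set with value $X$ at every parameter. The relative complement is $(F,E)'=(F',E)$, $F'(e)=X\setminus F(e)$. A soft topology on $X$ is a collection $\tau$ of soft sets $(F,E)$ over $X$ containing $\Phi$ and $\widetilde X$, closed under arbitrary unions and under intersections of two members; $(X,\tau,E)$ is then a soft topological space over $X$. Members of $\tau$ are soft open; $(F,E)$ is soft closed if $(F,E)'\in\tau$. The soft closure $\overline{(F,E)}$ is the intersection of all soft closed sets containing $(F,E)$. A soft set $(F,E)$ is soft semi-open if there is a soft open set $(G,E)$ with $(G,E)\subseteq(F,E)\subseteq\overline{(G,E)}$; it is soft semi-closed if $(F,E)'$ is soft semi-open. The soft semi-interior $\mathrm{int}^s(F,E)$ is the union of all soft semi-open sets contained in $(F,E)$; the soft semi-exterior is $\mathrm{ext}^s(F,E)=\mathrm{int}^s((F,E)')$;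 the soft semi-boundary is $\mathrm{bd}^s(F,E)=(\mathrm{int}^s(F,E)\cup \mathrm{ext}^s(F,E))'$. *)

(* Defs.v *)
From mathcomp Require Import all_boot boolp classical_sets.

Set Implicit Arguments.
Unset Strict Implicit.
Unset Printing Implicit Defensive.

Local Open Scope classical_set_scope.

Definition soft_set (X E : Type) : Type := E -> set X.

Section SoftSets.
Variables X E : Type.
Implicit Types (F G H : soft_set X E) (A : set (soft_set X E)).

Definition soft_null : soft_set X E := fun _ => set0.

Definition soft_absolute : soft_set X E := fun _ => setT.

Definition soft_subset F G : Prop := forall e, F e `<=` G e.

Definition soft_union F G : soft_set X E := fun e => F e `|` G e.

Definition soft_inter F G : soft_set X E := fun e => F e `&` G e.

Definition soft_compl F : soft_set X E := fun e => ~` F e.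

Definition soft_bigunion A : soft_set X E := fun e => \bigcup_(F in A) F e.

Definition soft_biginter A : soft_set X E := fun e => \bigcap_(F in A) F e.

End SoftSets.

Arguments soft_null {X E}.
Arguments soft_absolute {X E}.

Record soft_topology (X E : Type) (tau : set (soft_set X E)) : Prop := {
  soft_topology_null : tau soft_null;
  soft_topology_absolute : tau soft_absolute;
  soft_topology_bigunion : forall A : set (soft_set X E),
    A `<=` tau -> tau (soft_bigunion A);
  soft_topology_inter : forall F G : soft_set X E,
    tau F -> tau G -> tau (soft_inter F G)
}.

Section SoftTopology.
Variables (X E : Type) (tau : set (soft_set X E)).
Implicit Types F G H : soft_set X E.

Definition soft_open F : Prop := tau F.

Definition soft_closed F : Prop := soft_open (soft_compl F).

Definition soft_closure F : soft_set X E :=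
  soft_biginter [set H | soft_closed H /\ soft_subset F H].

Definition soft_semi_open F : Prop :=
  exists G, [/\ soft_open G, soft_subset G F & soft_subset F (soft_closure G)].

Definition soft_semi_closed F : Prop := soft_semi_open (soft_compl F).

Definition soft_semi_interior F : soft_set X E :=
  soft_bigunion [set G | soft_semi_open G /\ soft_subset G F].

Definition soft_semi_exterior F : soft_set X E :=
  soft_semi_interior (soft_compl F).

Definition soft_semi_boundary F : soft_set X E :=
  soft_compl (soft_union (soft_semi_interior F) (soft_semi_exterior F)).

End SoftTopology.

(* Main.v *)
Require Import Defs.
From mathcomp Require Import all_boot boolp classical_sets.

(** Arbitrary unions of soft semi-open sets are soft semi-open, so the
    semi-interior of [F] is the largest soft semi-open subset of [F], and [F]
    is semi-open exactly when it lies inside its own semi-interior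
    ([soft_semi_openE]).  The semi-boundary is the complement of the union of
    the semi-interior and the semi-exterior; as the semi-exterior is disjoint
    from [F], the part of [F] that misses the boundary is exactly the
    semi-interior of [F].  Hence [F] misses its boundary iff it is contained in
    its semi-interior, which is the first equivalence.

    The boundary is unchanged when [F] is replaced by its complement, and being
    contained in [F] means missing the complement of [F]; so the second
    equivalence is the first one applied to the complement. *)

Local Open Scope classical_set_scope.

Section SemiOpen.
Variables (X E : Type) (tau : set (soft_set X E)).
Implicit Types (F G : soft_set X E) (A : set (soft_set X E)).

Lemma soft_complK F : soft_compl (soft_compl F) = F.
Proof. by apply: funext => e; apply: setCK. Qed.

Lemma soft_closureS F G :
  soft_subset F G -> soft_subset (soft_closure tau F) (soft_closure tau G).
Proof.
move=> FG e x clFx H [Hclosed GH]; apply: clFx; split=> // e' y Fy.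
exact/GH/FG.
Qed.

Lemma soft_semi_interior_sub F : soft_subset (soft_semi_interior tau F) F.
Proof. by move=> e x [G [_ GF] Gx]; apply: GF. Qed.

(** The open core witnessing semi-openness is the union of all open sets inside
    the union of [A]: it contains the core of every member of [A], so its
    closure contains every member, and no core has to be chosen. *)
Lemma soft_semi_open_bigunion A : soft_topology tau ->
  A `<=` soft_semi_open tau -> soft_semi_open tau (soft_bigunion A).
Proof.
move=> tau_top Aso.
exists (soft_bigunion [set G | tau G /\ soft_subset G (soft_bigunion A)]).
split.
- by apply: (soft_topology_bigunion tau_top) => G [].
- by move=> e x [G [_ GA] Gx]; apply: GA.
- move=> e x [F AF Fx]; have [G [Gopen GF FclG]] := Aso _ AF.
  apply: soft_closureS (FclG _ _ Fx) => e' y Gy.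
  exists G => //; split=> // e'' z Gz.
  by exists F => //; apply: GF.
Qed.

Lemma soft_semi_openE F : soft_topology tau ->
  soft_semi_open tau F <-> soft_subset F (soft_semi_interior tau F).
Proof.
move=> tau_top; split=> [Fso e x Fx|Fint].
- by exists F => //; split=> // e'.
- have <- : soft_semi_interior tau F = F.
    apply: funext => e; apply/seteqP.
    by split; [apply: soft_semi_interior_sub|apply: Fint].
  by apply: soft_semi_open_bigunion => // G [].
Qed.

Lemma soft_semi_boundaryC F :
  soft_semi_boundary tau (soft_compl F) = soft_semi_boundary tau F.
Proof.
rewrite /soft_semi_boundary /soft_semi_exterior soft_complK.
by congr soft_compl; apply: funext => e; apply: setUC.
Qed.

Lemma soft_inter_semi_boundary_eq0 F :
  soft_inter F (soft_semi_boundary tau F) = soft_null <->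
  soft_subset F (soft_semi_interior tau F).
Proof.
split=> [F0 e x Fx|Fint].
- apply: contrapT => Nint.
  suff : soft_inter F (soft_semi_boundary tau F) e x by rewrite F0.
  (* A point of [F] cannot lie in the exterior, which sits in the complement. *)
  by split=> // -[//|/soft_semi_interior_sub].
- apply: funext => e; apply/seteqP; split=> // x [Fx].
  by apply; left; apply: Fint.
Qed.

Lemma soft_inter_compl_eq0 F G :
  soft_inter (soft_compl F) G = soft_null <-> soft_subset G F.
Proof.
split=> [FG0 e x Gx|GF].
- apply: contrapT => NFx.
  suff : soft_inter (soft_compl F) G e x by rewrite FG0.
  by split.
- by apply: funext => e; apply/seteqP; split=> // x [NFx /GF].
Qed.

End SemiOpen.

Theorem theorem3p15 (X E : Type) (E_nonempty : inhabited E)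
    (tau : set (soft_set X E)) (tau_top : soft_topology tau)
    (F : soft_set X E) :
  (soft_semi_open tau F <->
     soft_inter F (soft_semi_boundary tau F) = soft_null) /\
  (soft_semi_closed tau F <->
     soft_subset (soft_semi_boundary tau F) F).
Proof.
have openP G : soft_semi_open tau G <->
    soft_inter G (soft_semi_boundary tau G) = soft_null.
  apply: (iff_trans (soft_semi_openE _ _ _ G tau_top)).
  by apply: iff_sym; apply: soft_inter_semi_boundary_eq0.
split; first exact: openP.
apply: (iff_trans (openP (soft_compl F))).
by rewrite soft_semi_boundaryC; apply: soft_inter_compl_eq0.
Qed.
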